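(* Let $\mathfrak{B}$ be a bornology on a metric space $X$ with a closed base. Let the ideals $\mathcal{I}$ and $\mathcal{J}$ on $\omega$ each have a pseudounion. The following statements are equivalent. (1) $X$ satisfies $\mathrm{S}_1(\mathcal{I}\text{-}\Gamma_{\mathfrak{B}^s},\mathcal{J}\text{-}\Gamma_{\mathfrak{B}^s})$. (2) $X$ satisfies $\mathrm{S}_1(\Gamma_{\mathfrak{B}^s},\Gamma_{\mathfrak{B}^s})$.
   Context: $(X,d)$ is an infinite metric space; $\omega$ is the set of natural numbers. A bornology $\mathfrak{B}$ on $X$ is a family of subsets of $X$ that is closed under subsets and finite unions and covers $X$. A base of $\mathfrak{B}$ is a subfamily $\mathfrak{B}_0\subseteq\mathfrak{B}$ such that every $B\in\mathfrak{B}$ is contained in some $B_0\in\mathfrak{B}_0$; it is a closed base if its members are closed. For $B\in\mathfrak{B}$, $\delta>0$: $B^\delta=\bigcup_{x\in B}\{y\in X:d(x,y)<\delta\}$. An ideal on $\omega$ is a family $\mathcal{I}\subseteq\mathcal{P}(\omega)$ closed under subsets and finite unions, containing all finite sets, with $\omega\notin\mathcal{I}$. A set $A\subseteq\omega$ is a pseudounion of $\mathcal{I}$ if $\omega\setminus A$ is infinite and $I\setminus A$ is finite for every $I\in\mathcal{I}$. Covers of $X$ never contain $X$ as an element. An open cover $\{U_n:n\in\omega\}$ (with its enumeration) is a $\gamma_{\mathfrak{B}^s}$-cover if it is infinite and for each $B\in\mathfrak{B}$ there are $n_0\in\omega$ and positive reals $\delta_n$ ($n\geq n_0$) with $B^{\delta_n}\subseteq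 U_n$ for all $n\geq n_0$; $\Gamma_{\mathfrak{B}^s}$ is the class of these. A countable open cover $\{U_n:n\in\omega\}$ (with its enumeration) is an $\mathcal{I}$-$\gamma_{\mathfrak{B}^s}$-cover if for each $B\in\mathfrak{B}$ there is a sequence $\{\delta_n\}$ of positive reals with $\{n\in\omega:B^{\delta_n}\nsubseteq U_n\}\in\mathcal{I}$; $\mathcal{I}\text{-}\Gamma_{\mathfrak{B}^s}$ is the class of these. $\mathrm{S}_1(\mathcal{A},\mathcal{B})$: for every sequence $\{A_n:n\in\omega\}$ of elements of $\mathcal{A}$ there are $a_n\in A_n$ ($n\in\omega$) such that $\{a_n:n\in\omega\}\in\mathcal{B}$ (for enumerated covers, with the enumeration $n\mapsto a_n$). *)

(* Defs.v *)
From HB Require Import structures.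
From mathcomp Require Import all_boot all_order all_algebra.
From mathcomp Require Import all_classical all_reals all_analysis.

Set Implicit Arguments.
Unset Strict Implicit.
Unset Printing Implicit Defensive.

Import Order.TTheory GRing.Theory Num.Theory.
Local Open Scope classical_set_scope.
Local Open Scope ring_scope.

(* [X] itself may belong to a bornology. *)
Record is_bornology (X : Type) (BB : set (set X)) : Prop := IsBornology {
  bornology_sub : forall A B : set X, A `<=` B -> BB B -> BB A ;
  bornology_setU : forall A B : set X, BB A -> BB B -> BB (A `|` B) ;
  bornology_cover : \bigcup_(B in BB) B = [set: X] }.

Definition bornology_base (X : Type) (BB BB0 : set (set X)) : Prop :=
  BB0 `<=` BB /\ forall B, BB B -> exists2 B0, BB0 B0 & B `<=` B0.

Definition has_closed_base (X : topologicalType) (BB : set (set X)) : Prop :=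
  exists BB0 : set (set X),
    bornology_base BB BB0 /\ forall B, BB0 B -> closed B.

Definition enlargement (R : realType) (X : metricType R)
    (B : set X) (delta : R) : set X :=
  \bigcup_(x in B) [set y | mdist x y < delta].

Record is_ideal (I : set (set nat)) : Prop := IsIdeal {
  ideal_sub : forall A B : set nat, A `<=` B -> I B -> I A ;
  ideal_setU : forall A B : set nat, I A -> I B -> I (A `|` B) ;
  ideal_finite : forall A : set nat, finite_set A -> I A ;
  ideal_proper : ~ I [set: nat] }.

Definition pseudounion (I : set (set nat)) (A : set nat) : Prop :=
  infinite_set (~` A) /\ forall B, I B -> finite_set (B `\` A).

Definition has_pseudounion (I : set (set nat)) : Prop :=
  exists A : set nat, pseudounion I A.

(* A countable cover is represented by its enumeration, which need not be
   injective. Covers never contain the whole space as an element. *)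
Definition enum_open_cover (X : topologicalType) (U : nat -> set X) : Prop :=
  [/\ forall n, open (U n),
      forall n, U n <> [set: X] &
      \bigcup_n U n = [set: X]].

(* Infinitely many distinct members is required, hence [range U]. *)
Definition Gamma_Bs (R : realType) (X : metricType R) (BB : set (set X)) :
    set (nat -> set X) :=
  [set U | [/\ enum_open_cover U,
    infinite_set (range U) &
    forall B, BB B -> exists n0 : nat, exists delta : nat -> R,
      forall n, (n0 <= n)%N ->
        0 < delta n /\ enlargement B (delta n) `<=` U n]].

Definition ideal_Gamma_Bs (R : realType) (X : metricType R)
    (I : set (set nat)) (BB : set (set X)) : set (nat -> set X) :=
  [set U | enum_open_cover U /\
    forall B, BB B -> exists delta : nat -> R,
      (forall n, 0 < delta n) /\
      I [set n | ~ (enlargement B (delta n) `<=` U n)]].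

(* Selection principle for classes of enumerated covers; the selected family
   [a] carries the enumeration [n |-> a n]. *)
Definition S1 (X : Type) (AA CC : set (nat -> set X)) : Prop :=
  forall U : nat -> nat -> set X, (forall n, AA (U n)) ->
    exists a : nat -> set X, (forall n, range (U n) (a n)) /\ CC a.

(* Main.v *)
Require Import Defs.
From mathcomp Require Import all_boot all_order all_algebra.
From mathcomp Require Import all_classical all_reals all_analysis.

(** Every notion here is governed by one ideal: a gamma-cover is exactly an
    ideal gamma-cover for the ideal of finite sets ([Gamma_BsE]); the requirement
    of infinitely many distinct members is automatic, because a member repeated
    infinitely often would have to contain every point of the space.

    A pseudounion [A] of an ideal [I] yields a map [k] with [k n >= n] and values
    outside [A]. Each member of [I] then meets the values of [k] only finitely
    often, so reindexing along [k] turns an [I]-gamma-cover into a gamma-cover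
    ([ideal_Gamma_Bs_reindex]). The two implications follow.

    From the classical principle to the ideal one: reindex each given cover
    along [k] for a pseudounion of [I], select a gamma-cover from the reindexed
    covers, and recall that finite sets belong to [J].

    Conversely, gamma-covers [U 0, U 1, ...] are [I]-gamma-covers, but reindexing
    the [J]-gamma-cover selected from them would give at place [n] a member
    of [U (k n)], not of [U n]. So the selection is made from the covers
    [fun m => U 0 m `&` ... `&` U n m]. The set selected at place [k n >= n] then
    lies inside a member of [U n], and enlarging the members of a gamma-cover to
    proper open sets keeps it a gamma-cover. *)

Set Implicit Arguments.
Unset Strict Implicit.
Unset Printing Implicit Defensive.

Import Order.TTheory GRing.Theory Num.Theory.
Local Open Scope classical_set_scope.
Local Open Scope ring_scope.

(** * Sets of naturals *)

Lemma finite_set_is_ideal : is_ideal (@finite_set nat).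
Proof.
split=> [A B AB|A B fA fB|A //|]; first exact: sub_finite_set.
- by rewrite finite_setU.
- exact: infinite_nat.
Qed.

Lemma finite_set_eventually (P : set nat) :
  finite_set (~` P) <-> exists n0, forall n, (n0 <= n)%N -> P n.
Proof.
split=> [/finite_seqP[s sE]|[n0 Pn0]].
- exists (\max_(i <- s) i).+1%N => n ltn; apply: contrapT => nP.
  have ns : n \in s by have : (~` P) n by []; rewrite sE.
  by move: ltn; rewrite ltnNge (leq_bigmax_seq _ ns isT).
- apply: (sub_finite_set _ (finite_II n0)) => n /= nP.
  by rewrite ltnNge; apply/negP => /Pn0.
Qed.

Lemma infinite_set_next (S : set nat) : infinite_set S ->
  exists k : nat -> nat, forall n, (n <= k n)%N /\ S (k n).
Proof.
move=> Sinf.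
suff /choice[k kP] : forall n, exists m, (n <= m)%N /\ S m by exists k.
move=> n.
apply: contrapT => noS; apply: Sinf.
apply: (sub_finite_set _ (finite_II n)) => m /= Sm.
by rewrite ltnNge; apply/negP => nm; apply: noS; exists m.
Qed.

(** This is the only way in which a pseudounion gets used: it makes every
    member of the ideal invisible, up to finitely many indices, after the
    substitution [k]. *)
Lemma has_pseudounion_reindex (I : set (set nat)) : has_pseudounion I ->
  exists k : nat -> nat, (forall n, (n <= k n)%N) /\
    forall B, I B -> finite_set (k @^-1` B).
Proof.
move=> [A [/infinite_set_next[k kP] IA]]; exists k; split=> [n|B /IA fB].
  by have [] := kP n.
have : finite_set (~` ~` (B `\` A)) by rewrite setCK.
move=> /finite_set_eventually[n0 n0P].
rewrite -[_ @^-1` _]setCK; apply/finite_set_eventually.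
exists n0 => n n0n kB; have [nk kA] := kP n.
exact: (n0P _ (leq_trans n0n nk)).
Qed.

(** * Uniform inclusion of a set in a cover member *)

Section covers.
Variables (R : realType) (X : metricType R).
Implicit Types (B V W : set X) (U : nat -> set X) (BB : set (set X)).

Definition uniformly_inside B V :=
  exists2 delta : R, 0 < delta & enlargement B delta `<=` V.

Lemma uniformly_inside_subset B V : uniformly_inside B V -> B `<=` V.
Proof.
move=> [delta d0 BV] x Bx; apply: BV; exists x => //=.
by rewrite mdistxx.
Qed.

Lemma uniformly_insideS B V W :
  V `<=` W -> uniformly_inside B V -> uniformly_inside B W.
Proof. by move=> VW [d d0 BV]; exists d => //; exact: subset_trans VW. Qed.

Lemma uniformly_insideI B V W :
  uniformly_inside B V -> uniformly_inside B W -> uniformly_inside B (V `&` W).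
Proof.
move=> [d d0 BV] [e e0 BW]; exists (Num.min d e); first by rewrite lt_min d0.
move=> y [x Bx /=]; rewrite lt_min => /andP[xyd xye].
by split; [apply: BV|apply: BW]; exists x.
Qed.

(** The sequence of radii in the definition can be chosen index by index, and
    the covering property comes for free: the exceptional set of a member [B]
    of the bornology is not all of [nat], so some [U n] contains [B]. *)
Lemma ideal_Gamma_BsP (I : set (set nat)) BB U :
  is_ideal I -> is_bornology BB ->
  ideal_Gamma_Bs I BB U <->
  [/\ forall n, open (U n), forall n, U n <> [set: X] &
      forall B, BB B -> I [set n | ~ uniformly_inside B (U n)]].
Proof.
move=> hI hBB; split=> [[[Uo UT _] UI]|[Uo UT UI]].
  split=> // B /UI[delta [d0 ID]]; apply: (ideal_sub hI _ ID) => n /= nBU BU.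
  by apply: nBU; exists (delta n).
split=> [|B /UI IB].
  split=> //; rewrite -subTset => x _.
  have : (\bigcup_(B in BB) B) x by rewrite (bornology_cover hBB).
  move=> [B /UI IB Bx]; apply: contrapT => nUx; apply: (ideal_proper hI).
  apply: (ideal_sub hI _ IB) => n _ /= /uniformly_inside_subset BU.
  by apply: nUx; exists n => //; exact: BU.
have /choice[delta dP] : forall n, exists d : R,
    0 < d /\ (uniformly_inside B (U n) -> enlargement B d `<=` U n).
  move=> n; have [[d d0 BU]|nBU] := pselect (uniformly_inside B (U n)).
    by exists d.
  by exists 1; split=> // /nBU.
exists delta; split=> [n|]; first by have [] := dP n.
by apply: (ideal_sub hI _ IB) => n /= nBU BU; apply: nBU; apply (dP n).2.
Qed.

(** A cover whose exceptional sets are finite takes each value finitely often: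
    if [V] misses [x], every index of [V] is exceptional for a member of the
    bornology containing [x]. *)
Lemma infinite_range_ideal_Gamma_Bs BB U : is_bornology BB ->
  ideal_Gamma_Bs finite_set BB U -> infinite_set (range U).
Proof.
move=> hBB /(ideal_Gamma_BsP _ finite_set_is_ideal hBB)[_ UT Ufin] frU.
apply: infinite_nat.
apply: (@sub_finite_set _ _ (\bigcup_(V in range U) (U @^-1` [set V]))).
  by move=> n _; exists (U n) => //; exists n.
apply: bigcup_finite => // V [m _ UmV].
have [x nVx] : exists x, ~ V x.
  by apply/existsNP => VT; apply: (UT m); rewrite UmV -subTset => x _.
have : (\bigcup_(B in BB) B) x by rewrite (bornology_cover hBB).
move=> [B /Ufin fB Bx]; apply: (sub_finite_set _ fB) => n /= ->.
by move=> /uniformly_inside_subset BV; apply: nVx; exact: BV.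
Qed.

Lemma Gamma_BsE BB : is_bornology BB ->
  Gamma_Bs BB = ideal_Gamma_Bs finite_set BB.
Proof.
move=> hBB; apply/seteqP; split=> U UG.
  have [[Uo UT _] _ UB] := UG.
  apply/(ideal_Gamma_BsP _ finite_set_is_ideal hBB); split=> // B.
  move=> /UB[n0 [delta dP]]; apply/finite_set_eventually; exists n0 => n n0n.
  by have [d0 BU] := dP n n0n; exists (delta n).
split; [exact: UG.1|exact: infinite_range_ideal_Gamma_Bs UG|].
move=> B /UG.2[delta [d0 fB]].
have /finite_set_eventually[n0 n0P] := fB.
by exists n0, delta => n n0n; split; [exact: d0|exact: n0P].
Qed.

(** * Operations on ideal gamma-covers *)

Lemma ideal_Gamma_Bs_finite (I : set (set nat)) BB : is_ideal I ->
  ideal_Gamma_Bs finite_set BB `<=` ideal_Gamma_Bs I BB.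
Proof.
move=> hI U [Uc UB]; split=> // B /UB[delta [d0 fB]].
by exists delta; split=> //; exact: (ideal_finite hI).
Qed.

(** Covers are compared through a superset family [V] as well, since the
    selected sets have to be replaced by larger ones. *)
Lemma ideal_Gamma_Bs_reindex (I : set (set nat)) BB (k : nat -> nat)
    U (V : nat -> set X) :
  is_ideal I -> is_bornology BB ->
  (forall S, I S -> finite_set (k @^-1` S)) ->
  (forall n, open (V n)) -> (forall n, V n <> [set: X]) ->
  (forall n, U (k n) `<=` V n) ->
  ideal_Gamma_Bs I BB U -> ideal_Gamma_Bs finite_set BB V.
Proof.
move=> hI hBB kI Vo VT UV /(ideal_Gamma_BsP _ hI hBB)[_ _ UI].
apply/(ideal_Gamma_BsP _ finite_set_is_ideal hBB); split=> // B /UI/kI.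
apply: sub_finite_set => n /= nBV BU; apply: nBV.
exact: uniformly_insideS (UV n) BU.
Qed.

Lemma ideal_Gamma_BsI (I : set (set nat)) BB U (V : nat -> set X) :
  is_ideal I -> is_bornology BB ->
  ideal_Gamma_Bs I BB U -> ideal_Gamma_Bs I BB V ->
  ideal_Gamma_Bs I BB (fun n => U n `&` V n).
Proof.
move=> hI hBB /(ideal_Gamma_BsP _ hI hBB)[Uo UT UI].
move=> /(ideal_Gamma_BsP _ hI hBB)[Vo _ VI].
apply/(ideal_Gamma_BsP _ hI hBB); split=> [n|n UVT|B BBB].
- exact: openI.
- by apply: (UT n); rewrite -subTset -UVT => x [].
- apply: (ideal_sub hI _ (ideal_setU hI (UI B BBB) (VI B BBB))) => n /= nUV.
  apply: contrapT => /not_orP[/contrapT BU /contrapT BV].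
  by apply: nUV; exact: uniformly_insideI.
Qed.

Lemma ideal_Gamma_Bs_bigcap (I : set (set nat)) BB (U : nat -> nat -> set X) n :
  is_ideal I -> is_bornology BB -> (forall i, ideal_Gamma_Bs I BB (U i)) ->
  ideal_Gamma_Bs I BB (fun m => \bigcap_(i in `I_n.+1) U i m).
Proof.
move=> hI hBB UG; elim: n => [|n IHn].
  suff -> : (fun m => \bigcap_(i in `I_1) U i m) = U 0%N by [].
  by apply/funext => m; rewrite IIS II0 set0U bigcap_set1.
suff -> : (fun m => \bigcap_(i in `I_n.+2) U i m) =
    (fun m => (\bigcap_(i in `I_n.+1) U i m) `&` U n.+1 m).
  exact: ideal_Gamma_BsI.
by apply/funext => m; rewrite IIS bigcap_setU bigcap_set1.
Qed.

End covers.

Theorem theorem3p13 (R : realType) (X : metricType R)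
    (hX : infinite_set [set: X])
    (BB : set (set X)) (hBB : is_bornology BB) (hbase : has_closed_base BB)
    (I J : set (set nat)) (hI : is_ideal I) (hJ : is_ideal J)
    (hpI : has_pseudounion I) (hpJ : has_pseudounion J) :
  S1 (ideal_Gamma_Bs I BB) (ideal_Gamma_Bs J BB) <->
  S1 (Gamma_Bs BB) (Gamma_Bs BB).
Proof.
rewrite (Gamma_BsE hBB); split=> HS U UG.
- have [k [lek kJ]] := has_pseudounion_reindex hpJ.
  pose W n m := \bigcap_(i in `I_n.+1) U i m.
  have WG n : ideal_Gamma_Bs I BB (W n).
    apply: (ideal_Gamma_Bs_finite hI).
    exact: ideal_Gamma_Bs_bigcap finite_set_is_ideal hBB UG.
  have [a [aW aG]] := HS W WG.
  have /choice[m mP] : forall n, exists m, W n m = a n.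
    by move=> n; have [m _ Wm] := aW n; exists m.
  exists (fun n => U n (m (k n))); split=> [n|]; first by exists (m (k n)).
  apply: (ideal_Gamma_Bs_reindex hJ hBB kJ _ _ _ aG) => n.
  + by have [[Uo _ _] _] := UG n.
  + by have [[_ UT _] _] := UG n.
  + by rewrite -mP => x Wx; apply: Wx; rewrite /= ltnS.
- have [k [_ kI]] := has_pseudounion_reindex hpI.
  have [|a [aU aG]] := HS (fun n m => U n (k m)).
    move=> n; have [[Uo UT _] _] := UG n.
    by apply: (ideal_Gamma_Bs_reindex hI hBB kI _ _ _ (UG n)) => m.
  exists a; split=> [n|]; last exact: (ideal_Gamma_Bs_finite hJ).
  by have [m _ <-] := aU n; exists (k m).
Qed.
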